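(* Let $S_1,\dots,S_k$ be automaton semigroups and let $T$ be a finite semigroup with a right zero. Let $Y$ be the semilattice with $k+1$ elements, indexing the semigroups $S_1,\dots,S_k,T$, in which the elements corresponding to $S_1,\dots,S_k$ are mutually incomparable and are all greater than the element corresponding to $T$, which is the minimum element of $Y$. For each $i\in\{1,\dots,k\}$ let $\phi_i:S_i\to T$ be a homomorphism. Then the strong semilattice of semigroups $\mathcal{S}[Y;S_1,\dots,S_k,T;\phi_1,\dots,\phi_k]$ is an automaton semigroup.
   Context: An automaton is a triple $\mathcal{A}=(Q,B,\delta)$ where $Q$ is a finite set of states, $B$ is a finite alphabet of symbols, and $\delta$ is a transformation of $Q\times B$ (a map $Q\times B\to Q\times B$). Each state $q\in Q$ acts on the right on the set $B^*$ of finite words over $B$: for $\alpha=\alpha_1\alpha_2\cdots\alpha_n\in B^*$, $\alpha\cdot q=\beta_1\beta_2\cdots\beta_n$ where $q_0=q$ and $(q_{i-1},\alpha_i)\delta=(q_i,\beta_i)$ for $i=1,\dots,n$. A non-empty word $w=w_1\cdots w_m\in Q^+$ acts by $\alpha\cdot w=(\cdots((\alpha\cdot w_1)\cdot w_2)\cdots)\cdot w_m$. Regarding $B^*$ as a rooted tree (the children of $\alpha$ are the words $\alpha b$, $b\in B$), this gives a homomorphism $\phi:Q^+\to\operatorname{End}B^*$ to the endomorphism semigroup of the tree (maps written on the right); its image is denoted $\Sigma(\mathcal{A})$. A semigroup $S$ is an automaton semigroup if there is an automaton $\mathcal{A}$ with $S\simeq\Sigma(\mathcal{A})$. A right zero of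 a semigroup $T$ is an element $z\in T$ with $tz=z$ for all $t\in T$. Strong semilattice of semigroups: let $Y$ be a (meet-)semilattice, for each $\alpha\in Y$ let $S_\alpha$ be a semigroup, and for $\alpha\geq\beta$ let $\phi_{\alpha,\beta}:S_\alpha\to S_\beta$ be a homomorphism (written on the right) such that $\phi_{\alpha,\alpha}$ is the identity and $\phi_{\alpha,\beta}\phi_{\beta,\gamma}=\phi_{\alpha,\gamma}$ whenever $\alpha\geq\beta\geq\gamma$. The strong semilattice of semigroups $\mathcal{S}[Y;S_\alpha;\phi_{\alpha,\beta}]$ is the disjoint union $\bigcup_{\alpha\in Y}S_\alpha$ with multiplication $xy=(x\phi_{\alpha,\alpha\wedge\beta})(y\phi_{\beta,\alpha\wedge\beta})$ for $x\in S_\alpha$, $y\in S_\beta$. In $\mathcal{S}[Y;S_1,\dots,S_k,T;\phi_1,\dots,\phi_k]$ the only non-identity structure homomorphisms are the $\phi_i:S_i\to T$. *)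

(* Defs.v *)
From HB Require Import structures.
From mathcomp Require Import all_boot all_order.
From mathcomp Require Import boolp classical_sets cardinality.

Set Implicit Arguments.
Unset Strict Implicit.
Unset Printing Implicit Defensive.

Import Order.TTheory.

Local Open Scope group_scope.

(** The children of [s] are the [rcons s b]: an endomorphism fixes the root
    and maps every child of [s] to a child of the image of [s]. *)
Definition is_tree_end (B : Type) (f : seq B -> seq B) : Prop :=
  f [::] = [::] /\ forall s b, exists c, f (rcons s b) = rcons (f s) c.

Definition tree_end (B : choiceType) : Type :=
  {f : seq B -> seq B | `[< is_tree_end f >]}.

HB.instance Definition _ (B : choiceType) := Choice.on (tree_end B).
HB.instance Definition _ (B : choiceType) :=
  SubType.copy (tree_end B) {f : seq B -> seq B | `[< is_tree_end f >]}.

Section TreeEndSemigroup.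
Variable B : choiceType.
Implicit Types f g h : tree_end B.

Fact tree_end_mul_subproof f g : `[< is_tree_end (val g \o val f) >].
Proof.
case: f g => [f /= /asboolP[f0 fS]] [g /= /asboolP[g0 gS]].
apply/asboolP; split=> [|s b] /=; first by rewrite f0.
by have [c ->] := fS s b; apply: gS.
Qed.

(** Maps act on the right: in [f * g], [f] is applied first. *)
Definition tree_end_mul f g : tree_end B :=
  exist _ (val g \o val f) (tree_end_mul_subproof f g).

Fact tree_end_mulA : associative tree_end_mul.
Proof. by move=> f g h; apply: val_inj. Qed.

HB.instance Definition _ := isSemigroup.Build (tree_end B) tree_end_mulA.

End TreeEndSemigroup.

Record automaton := Automaton {
  state : finType;
  symbol : finType;
  delta : state * symbol -> state * symbol
}.

Section AutomatonSemigroup.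
Variable A : automaton.
Implicit Types (q : state A) (w : seq (state A)) (s : seq (symbol A)).

Fixpoint state_act q s : seq (symbol A) :=
  if s is a :: s' then
    (delta (q, a)).2 :: state_act (delta (q, a)).1 s'
  else [::].

Definition word_act w s : seq (symbol A) :=
  foldl (fun t q => state_act q t) s w.

Lemma state_act_tree_end q : is_tree_end (state_act q).
Proof.
split=> // s b; elim: s q => [|a s IHs] q /=.
  by exists (delta (q, b)).2.
by have [c ->] := IHs (delta (q, a)).1; exists c.
Qed.

Fact word_act_subproof w : `[< is_tree_end (word_act w) >].
Proof.
apply/asboolP; elim/last_ind: w => [|w q [w0 wS]].
  by split=> // s b; exists b.
have [q0 qS] := state_act_tree_end q.
split=> [|s b]; rewrite /word_act !foldl_rcons -!/(word_act w _).
  by rewrite w0.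
by have [c ->] := wS s b; apply: qS.
Qed.

Definition word_end w : tree_end (symbol A) :=
  exist _ (word_act w) (word_act_subproof w).

Lemma word_end_cat w1 w2 : word_end (w1 ++ w2) = word_end w1 * word_end w2.
Proof. by apply: val_inj; apply: funext => s; rewrite /= /word_act foldl_cat. Qed.

(** Words are non-empty: [Sigma] is the image of Q^+, not of Q^*. *)
Definition in_Sigma : pred (tree_end (symbol A)) :=
  fun f => `[< exists2 w, w <> [::] & f = word_end w >].

Definition Sigma : Type := {f : tree_end (symbol A) | in_Sigma f}.

HB.instance Definition _ := Choice.on Sigma.
HB.instance Definition _ :=
  SubType.copy Sigma {f : tree_end (symbol A) | in_Sigma f}.

Fact in_Sigma_mul : mulg_closed in_Sigma.
Proof.
move=> _ _ /asboolP[w1 w1N ->] /asboolP[w2 w2N ->]; apply/asboolP.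
by exists (w1 ++ w2); [case: w1 w1N | rewrite word_end_cat].
Qed.

HB.instance Definition _ :=
  SubChoice_isSubSemigroup.Build _ in_Sigma Sigma in_Sigma_mul.

End AutomatonSemigroup.

Definition semigroup_isog (S T : semigroupType) : Prop :=
  exists f : {multiplicative S -> T}, bijective f.

Definition automaton_semigroup (S : semigroupType) : Prop :=
  exists A : automaton, semigroup_isog S (Sigma A).

Definition is_right_zero (T : semigroupType) (z : T) : Prop :=
  forall t : T, t * z = z.

Record semilattice_system d (Y : meetSemilatticeType d) := SemilatticeSystem {
  component :> Y -> semigroupType;
  structure_hom : forall a b : Y,
    (b <= a)%O -> {multiplicative component a -> component b};
  structure_hom_id : forall (a : Y) (aa : (a <= a)%O) x,
    structure_hom aa x = x;
  structure_hom_comp : forall (a b c : Y)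
      (ba : (b <= a)%O) (cb : (c <= b)%O) (ca : (c <= a)%O) x,
    structure_hom cb (structure_hom ba x) = structure_hom ca x
}.

Definition strong_semilattice d (Y : meetSemilatticeType d)
    (F : semilattice_system Y) : Type := {a : Y & F a}.

HB.instance Definition _ d (Y : meetSemilatticeType d)
  (F : semilattice_system Y) := Choice.on (strong_semilattice F).

Section StrongSemilattice.
Variables (d : Order.disp_t) (Y : meetSemilatticeType d).
Variable F : semilattice_system Y.
Implicit Types x y z : strong_semilattice F.

Definition strong_mul x y : strong_semilattice F :=
  existT _ (tag x `&` tag y)%O
    (structure_hom F (leIl (tag x) (tag y)) (tagged x)
     * structure_hom F (leIr (tag y) (tag x)) (tagged y)).

Lemma structure_hom_existT (a b : Y) (ba : (b <= a)%O) (u : F a) : a = b ->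
  existT _ a u = existT _ b (structure_hom F ba u) :> strong_semilattice F.
Proof. by move=> ab; case: b / ab ba => aa; rewrite structure_hom_id. Qed.

Fact strong_mulA : associative strong_mul.
Proof.
case=> [a u] [b v] [c w]; rewrite /strong_mul /=.
have e : (a `&` (b `&` c))%O = (a `&` b `&` c)%O.
  exact: meetA.
have le : (a `&` b `&` c <= a `&` (b `&` c))%O.
  by rewrite e.
rewrite (structure_hom_existT le _ e) !gmulfM mulgA.
have la : (a `&` b `&` c <= a)%O.
  by rewrite -meetA leIl.
have lb : (a `&` b `&` c <= b)%O.
  by rewrite (le_trans (leIl _ _)) ?leIr.
have lbc : (a `&` b `&` c <= b `&` c)%O.
  by rewrite -meetA leIr.
apply: (congr1 (existT _ _)); congr (_ * _ * _).
- by rewrite !(structure_hom_comp _ _ la).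
- by rewrite (structure_hom_comp _ _ lbc) !(structure_hom_comp _ _ lb).
- by rewrite (structure_hom_comp _ _ lbc) (structure_hom_comp _ _ (leIr c _)).
Qed.

HB.instance Definition _ := isSemigroup.Build (strong_semilattice F) strong_mulA.

End StrongSemilattice.

(** [None] is the minimum, the [Some i] are mutually incomparable. *)
Definition fan (k : nat) : Type := option 'I_k.

HB.instance Definition _ k := Choice.on (fan k).

Section Fan.
Variable k : nat.
Implicit Types a b c : fan k.

Definition fan_le a b : bool := (a == None) || (a == b).
Definition fan_meet a b : fan k := if a == b then a else None.

Fact fan_le_refl : reflexive fan_le.
Proof. by move=> a; rewrite /fan_le eqxx orbT. Qed.

Fact fan_le_anti : antisymmetric fan_le.
Proof.
move=> a b /andP[/orP[/eqP->|/eqP->//]].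
by case/orP=> /eqP->.
Qed.

Fact fan_le_trans : transitive fan_le.
Proof.
move=> b a c /orP[/eqP->|/eqP->//] _.
by rewrite /fan_le eqxx.
Qed.

Fact fan_disp : Order.disp_t. Proof. exact: (Order.Disp tt tt). Qed.

HB.instance Definition _ :=
  Order.Le_isPOrder.Build fan_disp (fan k)
    fan_le_refl fan_le_anti fan_le_trans.

Fact fan_lexI a b c : (a <= fan_meet b c)%O = (a <= b)%O && (a <= c)%O.
Proof.
rewrite -![(_ <= _)%O]/(fan_le _ _) /fan_le /fan_meet.
case: (eqVneq b c) => [->|bc]; first by rewrite andbb.
case: (eqVneq a None) => //= aN; case: (eqVneq a b) => [->|] //=.
by rewrite (negPf bc).
Qed.

HB.instance Definition _ :=
  Order.POrder_isMeetSemilattice.Build fan_disp (fan k) fan_lexI.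

End Fan.

Section FanSystem.
Variables (k : nat) (S : 'I_k -> semigroupType) (T : semigroupType).
Variable phi : forall i, {multiplicative S i -> T}.

Definition fan_component (a : fan k) : semigroupType :=
  if a is Some i then S i else T.

Lemma fan_le_Some (i j : 'I_k) : (Some j <= Some i :> fan k)%O -> i = j.
Proof. by move=> /orP[/eqP|/eqP[->]]. Qed.

Lemma fan_le_None (j : 'I_k) : ~ (Some j <= None :> fan k)%O.
Proof. by case/orP=> /eqP. Qed.

(** Since [Some j <= Some i] forces [i = j], the first branch is the identity
    of [S i], up to transport. *)
Definition fan_map (a b : fan k) :
    (b <= a)%O -> fan_component a -> fan_component b :=
  match a, b with
  | Some i, Some j => fun ba x => ecast l (S l) (fan_le_Some ba) x
  | Some i, None => fun _ x => phi i x
  | None, Some j => fun ba _ => False_rect _ (fan_le_None ba)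
  | None, None => fun _ x => x
  end.

Fact fan_map_mul (a b : fan k) (ba : (b <= a)%O) :
  {morph fan_map ba : x y / x * y}.
Proof.
case: a b ba => [i|] [j|] ba x y //=.
- by move: (fan_le_Some ba) => {ba} ij; case: j / ij.
- exact: gmulfM.
Qed.

Definition fan_hom (a b : fan k) (ba : (b <= a)%O) :
    {multiplicative fan_component a -> fan_component b} :=
  HB.pack (fan_map ba) (isMultiplicative.Build _ _ (fan_map ba) (fan_map_mul ba)).

Fact fan_hom_id (a : fan k) (aa : (a <= a)%O) x : fan_hom aa x = x.
Proof.
case: a aa x => [i|] //= aa x.
by rewrite (eq_irrelevance (fan_le_Some aa) (erefl i)).
Qed.

Fact fan_hom_comp (a b c : fan k)
    (ba : (b <= a)%O) (cb : (c <= b)%O) (ca : (c <= a)%O) x :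
  fan_hom cb (fan_hom ba x) = fan_hom ca x.
Proof.
case: a b c ba cb ca x => [i|] [j|] [l|] ba cb ca x //=;
  try by [case: (fan_le_None ba) | case: (fan_le_None cb)].
- rewrite (eq_irrelevance (fan_le_Some ca)
             (etrans (fan_le_Some ba) (fan_le_Some cb))).
  move: (fan_le_Some ba) (fan_le_Some cb) => {ba cb ca} ij jl.
  by case: l / jl; case: j / ij.
- by move: (fan_le_Some ba) => {ba cb ca} ij; case: j / ij.
Qed.

Definition fan_system : semilattice_system (fan k) :=
  SemilatticeSystem fan_hom_id fan_hom_comp.

End FanSystem.

(* Main.v *)
From HB Require Import structures.
Require Import Defs.
From mathcomp Require Import all_boot all_order.
From mathcomp Require Import boolp classical_sets cardinality.

(** A semigroup is an automaton semigroup exactly when it is itself a possibly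
    infinite automaton over a finite alphabet: every element [s] sends a letter
    [c] to [out s c] and then goes on as the element [rest s c], compatibly with
    products, the induced action on words is faithful, and some finite
    generating set is closed under [rest]. This intrinsic form ([self_similar],
    with [automaton_self_similar] and [self_similar_automaton] for the two
    directions) replaces words over the states by elements of the semigroup, so
    a strong semilattice is treated by giving one action and checking it.

    Let [z] be a right zero of [T], and write [x!] for the image of [x] in [T].
    The alphabet consists of the letters of each [S i], one marker for each
    [i], the elements of [T] with an identity adjoined, and a sink.
    - An element of [S i] acts on the letters of [S i] as it does there, and
      fixes the marker of [i], going on as [z].
    - Every [x] multiplies a letter of [T] with identity on the right by [x!],
      and goes on as [x!].
    - In all other cases the letter becomes the sink, and the element goes on
      as [z].
    The delicate point is compatibility with products for [s] in [S i] followed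
    by [y] outside [S i], on a letter [b] of [S i]. The product lies in [T], so
    it must go on as [z], whereas the two factors go on as the restriction of
    [s] at [b], then [z]. The image in [T] of that restriction is not controlled
    by the image of [s]; since [z] is a right zero, it is absorbed
    ([fan_mul_zero]). Faithfulness holds because the adjoined identity reads off
    [x!], the markers tell the components apart, and the letters of [S i] carry
    the faithful action of [S i]. The markers matter when [S i] has no letter. *)

Set Implicit Arguments.
Unset Strict Implicit.
Unset Printing Implicit Defensive.

Import Order.TTheory.

Local Open Scope group_scope.

(** * Automaton semigroups as self-similar semigroups *)

Section Action.
Variables (S : semigroupType) (C : Type) (rest : S -> C -> S) (out : S -> C -> C).

Fixpoint self_act (s : S) (a : seq C) : seq C :=
  if a is c :: b then out s c :: self_act (rest s c) b else [::].

Lemma self_act_mul :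
    (forall s t c, out (s * t) c = out t (out s c)) ->
    (forall s t c, rest (s * t) c = rest s c * rest t (out s c)) ->
  forall s t a, self_act (s * t) a = self_act t (self_act s a).
Proof.
move=> outM restM s t a.
by elim: a s t => //= c a IH s t; rewrite outM restM IH.
Qed.

End Action.

(** [gen_ind] says that the generators generate: it is induction over the
    subsemigroup that they span. Faithfulness is stated on functions rather
    than pointwise; the two agree by extensionality. *)
Record self_similar (S : semigroupType) := SelfSimilar {
  gen : finType;
  letter : finType;
  gen_val : gen -> S;
  rest : S -> letter -> S;
  out : S -> letter -> letter;
  out_mul : forall s t c, out (s * t) c = out t (out s c);
  rest_mul : forall s t c, rest (s * t) c = rest s c * rest t (out s c);
  rest_gen : forall q c, exists p, rest (gen_val q) c = gen_val p;
  gen_ind : forall P : S -> Prop,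
    (forall q, P (gen_val q)) -> (forall s t, P s -> P t -> P (s * t)) ->
    forall s, P s;
  self_act_inj : injective (self_act rest out)
}.

(** The generators, restricted by [rest], form a finite automaton, whose
    states act as they do in [S]; by multiplicativity the transformations
    induced by non-empty words are the actions of the elements of [S], and
    faithfulness makes the correspondence bijective. *)
Lemma self_similar_automaton (S : semigroupType) :
  self_similar S -> automaton_semigroup S.
Proof.
case=> Q C v r o oM rM rG vI aI.
have /choice[d dE] : forall qc : Q * C, exists p, r (v qc.1) qc.2 = v p.
  by case=> q c; apply: rG.
pose A := Automaton (fun qc => (d qc, o (v qc.1) qc.2)).
have aM := self_act_mul oM rM.
have state_actE (q : state A) : state_act q =1 self_act r o (v q).
  by move=> a; elim: a q => //= c a IH q; rewrite IH (dE (q, c)).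
have /choice[w wP] : forall s, exists w : seq (state A),
    w <> [::] /\ word_act w =1 self_act r o s.
  elim/vI => [q|s t [w1 [w1N e1]] [w2 [_ e2]]].
    by exists [:: q : state A]; split=> // a; apply: state_actE.
  exists (w1 ++ w2); split=> [|a]; first by case: w1 w1N {e1}.
  by rewrite aM -e1 -e2 /word_act foldl_cat.
have wS s : in_Sigma (word_end (w s)).
  by apply/asboolP; exists (w s) => //; case: (wP s).
pose F s : Sigma A := exist _ (word_end (w s)) (wS s).
have FE s : val (val (F s)) = self_act r o s.
  by apply: funext => a; case: (wP s) => _; apply.
have FM : {morph F : s t / s * t}.
  move=> s t; apply/val_inj/val_inj; rewrite FE.
  by apply: funext => a; rewrite aM -!FE.
have /choice[G GK] : forall f, exists s, F s = f.
  case=> f fS; have /asboolP[u uN fE] := fS.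
  suff [s sE] : exists s, word_act u =1 self_act r o s.
    by exists s; apply/val_inj/val_inj; rewrite FE /= fE; apply: funext => a /=.
  case: u uN {fE} => // q u _; elim/last_ind: u => [|u p [s sE]].
    by exists (v q) => a; apply: state_actE.
  exists (s * v p) => a.
  by rewrite -rcons_cons /word_act foldl_rcons aM -sE state_actE.
pose Fm : {multiplicative S -> Sigma A} :=
  HB.pack F (isMultiplicative.Build _ _ F FM).
exists A, Fm.
by exists G => // s; apply: aI; rewrite -!FE GK.
Qed.

(** The restriction of a word of states after a letter is read. It is as long
    as the word, hence again stands for an element of the semigroup. *)
Fixpoint word_rest (A : automaton) (w : seq (state A)) (c : symbol A) :=
  if w is q :: w' then
    (delta (q, c)).1 :: word_rest w' (delta (q, c)).2
  else [::].

Lemma word_act_cons (A : automaton) (w : seq (state A)) c :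
  exists e, forall a, word_act w (c :: a) = e :: word_act (word_rest w c) a.
Proof.
elim: w c => [|q w IH] c; first by exists c.
by have [e eE] := IH (delta (q, c)).2; exists e => a; apply: eE.
Qed.

(** Whatever word represents an element, its transformation of the words that
    begin with [c] determines both the image of [c] and the transformation of
    the tails. The restriction is therefore well defined on the semigroup, and
    each law for [rest] is checked on the transformations. *)
Lemma automaton_self_similar (S : semigroupType) :
  automaton_semigroup S -> inhabited (self_similar S).
Proof.
case=> A [f [g fK gK]]; pose act s := val (val (f s)).
have actM s t a : act (s * t) a = act t (act s a) by rewrite /act gmulfM.
have actI s t : act s =1 act t -> s = t.
  by move=> /funext/val_inj/val_inj/(can_inj fK).
have actP s : exists2 w, w <> [::] & act s = word_act w.
  rewrite /act; case: (f s) => h /= /asboolP[w wN ->].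
  by exists w.
have wordP w : w <> [::] -> exists s, act s = word_act w.
  move=> wN; have wS : in_Sigma (word_end w) by apply/asboolP; exists w.
  by exists (g (exist _ (word_end w) wS)); rewrite /act gK.
have /choice[r rP] : forall sc : S * symbol A, exists t,
    exists e, forall a, act sc.1 (sc.2 :: a) = e :: act t a.
  case=> s c /=; have [w wN ->] := actP s.
  have [|t tE] := wordP (word_rest w c); first by case: w wN.
  by exists t; rewrite tE; apply: word_act_cons.
have [o oE] := choice rP.
have /choice[v vE] : forall q : state A, exists s, act s = state_act q.
  by move=> q; have [//|s sE] := wordP [:: q]; exists s.
(* Both sides are the image of [c :: a] under [s * t]: comparing heads and
   tails gives the laws for [out] and [rest]. *)
have stepM s t c a : act (s * t) (c :: a) =
    o (t, o (s, c)) :: act (r (s, c) * r (t, o (s, c))) a.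
  by rewrite !actM (oE (s, c)) (oE (t, o (s, c))).
have actE : self_act (fun s c => r (s, c)) (fun s c => o (s, c)) = act.
  apply/funext => s; apply/funext => a; elim: a s => [|c a IH] s /=.
    by have [w _ ->] := actP s; elim: w.
  by rewrite (oE (s, c)) IH.
constructor; refine (@SelfSimilar S (state A) (symbol A) v
  (fun s c => r (s, c)) (fun s c => o (s, c)) _ _ _ _ _).
- by move=> s t c; have := stepM s t c [::]; rewrite (oE (_, c)) => -[].
- move=> s t c; apply: actI => a; have := stepM s t c a.
  by rewrite (oE (_, c)) => -[].
- move=> q c; exists (delta (q, c)).1; apply: actI => a.
  by have := oE (v q, c) a; rewrite !vE => -[].
- move=> P Pv PM s; have [w] := actP s.
  case: w => // q w _; elim/last_ind: w s => [|w p IH] s sE.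
    by rewrite (_ : s = v q) //; apply: actI => a; rewrite sE vE.
  have [t tE] : exists t, act t = word_act (q :: w) by apply: wordP.
  rewrite (_ : s = t * v p); first by apply: PM => //; apply: IH.
  apply: actI => a.
  by rewrite sE actM tE vE -rcons_cons /word_act foldl_rcons.
- by rewrite actE => s t st; apply: actI => a; rewrite st.
Qed.

(** * Multiplication in a fan *)

(** Multiplying in any [F c] with [c] equal to the meet spares the transport
    along that equality; for instance the meet of [Some i] with itself is only
    provably [Some i]. *)
Lemma strong_mulE d (Y : meetSemilatticeType d) (F : semilattice_system Y)
    (x y : strong_semilattice F) (c : Y) (cx : (c <= tag x)%O)
    (cy : (c <= tag y)%O) :
  (tag x `&` tag y)%O = c ->
  x * y = existT _ c (structure_hom F cx (tagged x)
                      * structure_hom F cy (tagged y)).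
Proof.
move=> e; case: c / e cx cy => cx cy.
by rewrite (eq_irrelevance cx (leIl _ _)) (eq_irrelevance cy (leIr _ _)).
Qed.

Section Fan.
Variables (k : nat) (S : 'I_k -> semigroupType) (T : semigroupType).
Variable phi : forall i : 'I_k, {multiplicative S i -> T}.
Local Notation fanS := (strong_semilattice (fan_system phi)).

Definition fan_in (i : 'I_k) (s : S i) : fanS := existT _ (Some i : fan k) s.
Definition fan_bot (t : T) : fanS := existT _ (None : fan k) t.

Definition fan_down (x : fanS) : T :=
  match x with
  | existT (Some i) s => phi i s
  | existT None t => t
  end.

Lemma fanP (P : fanS -> Prop) :
  (forall i (s : S i), P (fan_in s)) -> (forall t, P (fan_bot t)) ->
  forall x, P x.
Proof. by move=> Pin Pbot [[i|] s]; [apply: Pin | apply: Pbot]. Qed.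

Lemma fan_tag_in (x : fanS) i : tag x = Some i -> exists s : S i, x = fan_in s.
Proof.
by case: x => a s /= /esym ai; case: a / ai s => s; exists s.
Qed.

Lemma fan_in_mul i (s t : S i) : fan_in s * fan_in t = fan_in (s * t).
Proof.
have ii : ((Some i : fan k) `&` (Some i : fan k))%O = Some i by apply: meetxx.
have le : ((Some i : fan k) <= Some i)%O by [].
rewrite (strong_mulE (x := fan_in s) (y := fan_in t) le le ii).
by rewrite !(structure_hom_id (s := fan_system phi)).
Qed.

Lemma fan_mul_bot (x y : fanS) :
  tag x <> tag y \/ tag x = None -> x * y = fan_bot (fan_down x * fan_down y).
Proof.
move=> xy; have e : (tag x `&` tag y)%O = None :> fan k.
  rewrite -[LHS]/(fan_meet (tag x) (tag y)) /fan_meet.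
  by case: eqP xy => [-> [|]|].
have lx : ((None : fan k) <= tag x)%O by [].
have ly : ((None : fan k) <= tag y)%O by [].
rewrite (strong_mulE lx ly e).
by case: x y {xy e} lx ly => [[i|] s] [[j|] t].
Qed.

Lemma fan_down_mul (x y : fanS) : fan_down (x * y) = fan_down x * fan_down y.
Proof.
have [e|xy] := pselect (tag x = tag y); last by rewrite fan_mul_bot //; left.
case: x y e => [[i|] s] [[j|] t] // e.
have [t' ->] := fan_tag_in (esym e).
by rewrite -/(fan_in s) fan_in_mul /= gmulfM.
Qed.

(** * The self-similar action of a fan *)

Variable D : forall i, self_similar (S i).

(** [U] codes the elements of the finite semigroup [T] as letters and states. *)
Variable U : finType.
Variables (enc : T -> U) (dec : U -> T) (encK : cancel enc dec).
Variables (z : T) (zP : is_right_zero z).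

(** The markers and the letters of the components together: [None] is the
    marker of the component. *)
Definition own_letter : finType := {i : 'I_k & option (letter (D i))}.

(** [None] is the sink; [Some (inr None)] is the identity adjoined to [T]. *)
Definition fan_letter : finType := option (own_letter + option U)%type.

Definition own_mk i (o : option (letter (D i))) : own_letter := existT _ i o.
Definition fan_own i (o : option (letter (D i))) : fan_letter :=
  Some (inl (own_mk o)).

(** [tagged_as] supplies the transport to the [i]-th component. Its first
    argument, the marker, would be its value for different tags, a case that
    the test excludes. *)
Definition own_view i (c : own_letter) : option (option (letter (D i))) :=
  if tag c == i then Some (tagged_as (own_mk (None : option (letter (D i)))) c)
  else None.

Lemma own_view_mk i (o : option (letter (D i))) :
  own_view i (own_mk o) = Some o.
Proof. by rewrite /own_view eqxx (tagged_asE (u := own_mk None) o). Qed.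

Lemma own_view_neq i j (o : option (letter (D i))) :
  i <> j -> own_view j (own_mk o) = None.
Proof. by move=> /eqP/negPf ij; rewrite /own_view /= ij. Qed.

Definition fan_out (x : fanS) (c : fan_letter) : fan_letter :=
  match c with
  | Some (inr (Some u)) => Some (inr (Some (enc (dec u * fan_down x))))
  | Some (inr None) => Some (inr (Some (enc (fan_down x))))
  | Some (inl c) =>
    if x is existT (Some i) s then
      if own_view i c is Some o then fan_own (omap (out s) o) else None
    else None
  | None => None
  end.

Definition fan_rest (x : fanS) (c : fan_letter) : fanS :=
  match c with
  | Some (inr _) => fan_bot (fan_down x)
  | Some (inl c) =>
    if x is existT (Some i) s then
      if own_view i c is Some (Some b) then fan_in (rest s b) else fan_bot z
    else fan_bot z
  | None => fan_bot z
  end.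

(** All of [T] is taken as generators, so that every element [fan_bot t]
    arising as a restriction is one of them. *)
Definition fan_gen : finType := ({i : 'I_k & gen (D i)} + U)%type.

Definition fan_gen_val (q : fan_gen) : fanS :=
  match q with
  | inl p => fan_in (gen_val (tagged p))
  | inr u => fan_bot (dec u)
  end.

(** Where the right zero enters: whatever an element becomes after reading a
    letter, it is forgotten as soon as the next factor goes on as [z]. *)
Lemma fan_mul_zero (x : fanS) : x * fan_bot z = fan_bot z.
Proof.
rewrite fan_mul_bot /= ?zP //.
by case: x => [[i|] s]; [left | right].
Qed.

Lemma fan_step_own i (s : S i) (o : option (letter (D i))) :
  fan_out (fan_in s) (fan_own o) = fan_own (omap (out s) o) /\
  fan_rest (fan_in s) (fan_own o)
    = if o is Some b then fan_in (rest s b) else fan_bot z.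
Proof. by rewrite /= own_view_mk. Qed.

Lemma fan_step_foreign (x : fanS) i (o : option (letter (D i))) :
  tag x <> Some i -> fan_out x (fan_own o) = None /\
                     fan_rest x (fan_own o) = fan_bot z.
Proof.
case: x => [[j|] s] //= ji; rewrite own_view_neq // => ij.
by apply: ji; rewrite ij.
Qed.

(** On a letter of the [i]-th component, all that matters is whether [x] and
    [y] lie in [S i]. If [x] does not, neither does [x * y], and both send the
    letter to the sink, where [y] goes on as [z]. If both do, this is the law
    in [S i]. If only [x] does, the restriction of [x] is absorbed by [z]. *)
Lemma fan_step_mul (x y : fanS) (c : fan_letter) :
  fan_out (x * y) c = fan_out y (fan_out x c) /\
  fan_rest (x * y) c = fan_rest x c * fan_rest y (fan_out x c).
Proof.
case: c => [[[i o]|u]|]; last by rewrite /= fan_mul_zero.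
- rewrite -[Some _]/(fan_own o).
  have [xi|xi] := pselect (tag x = Some i); last first.
    have [-> ->] := fan_step_foreign o xi.
    rewrite -[fan_rest y None]/(fan_bot z) fan_mul_zero.
    apply: fan_step_foreign => xyi; apply: xi.
    by move: xyi; rewrite -[LHS]/(fan_meet _ _) /fan_meet; case: eqP.
  have [s ->] := fan_tag_in xi.
  have [-> ->] := fan_step_own s o.
  have [yi|yi] := pselect (tag y = Some i).
    have [t ->] := fan_tag_in yi; rewrite fan_in_mul.
    have [-> ->] := fan_step_own (s * t) o.
    have [-> ->] := fan_step_own t (omap (out s) o).
    case: o => [b|] /=; first by rewrite out_mul rest_mul fan_in_mul.
    by rewrite fan_mul_zero.
  have [-> ->] := fan_step_foreign (omap (out s) o) yi.
  rewrite fan_mul_zero fan_mul_bot; last by left => /esym.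
  exact: fan_step_foreign.
- have restM : fan_bot (fan_down (x * y))
      = fan_bot (fan_down x) * fan_bot (fan_down y).
    by rewrite fan_down_mul fan_mul_bot //; right.
  by case: u => [u|]; split; first [exact: restM
    | rewrite /fan_out fan_down_mul ?encK ?mulgA].
Qed.

Lemma fan_act_in i (s : S i) (a : seq (letter (D i))) :
  self_act fan_rest fan_out (fan_in s) (map (fun b => fan_own (Some b)) a)
    = map (fun b => fan_own (Some b))
        (self_act (@rest _ (D i)) (@out _ (D i)) s a).
Proof.
elim: a s => //= b a IH s.
by rewrite own_view_mk IH.
Qed.

Lemma fan_own_inj i : injective (@fan_own i).
Proof.
move=> o1 o2 [/(congr1 (own_view i))].
by rewrite !own_view_mk => -[].
Qed.

(** Equal actions have equal outputs on single letters: the markers give the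
    component, and the identity of [T] gives the image in [T]. Inside [S i],
    words over its own letters suffice. *)
Lemma fan_act_inj : injective (self_act fan_rest fan_out).
Proof.
move=> x y xy.
have out_eq c : fan_out x c = fan_out y c.
  by have := congr1 (@^~ [:: c]) xy => -[].
have tag_eq : tag x = tag y.
  (* [w] sends the marker of [i] to the sink unless it lies in [S i]. *)
  have aux (v w : fanS) : (forall c, fan_out v c = fan_out w c) ->
      forall i, tag v = Some i -> tag w = Some i.
    move=> vw i vi; have [//|wi] := pselect (tag w = Some i).
    have [wN _] := fan_step_foreign None wi.
    have := vw (@fan_own i None); rewrite wN.
    by have [s ->] := fan_tag_in vi; rewrite /= own_view_mk.
  case xi : (tag x) => [i|]; first by rewrite (aux _ _ out_eq i).
  case yi : (tag y) => [i|] //.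
  by rewrite -xi (aux y x _ i).
case: x y tag_eq xy out_eq => [[i|] s] [[j|] t] //= e.
  case: e t => <- t xy _; congr (existT _ _ _).
  apply: (@self_act_inj _ (D i)); apply: funext => a.
  have := congr1 (@^~ (map (fun b => fan_own (Some b)) a)) xy.
  rewrite -/(fan_in s) -/(fan_in t) !fan_act_in.
  by apply: inj_map => b b' /fan_own_inj[].
move=> _ /(_ (Some (inr None))) [/(can_inj encK) st].
by rewrite st.
Qed.

Definition fan_self_similar : self_similar fanS.
Proof.
refine (@SelfSimilar _ fan_gen fan_letter fan_gen_val fan_rest fan_out _ _ _ _ _).
- by move=> x y c; case: (fan_step_mul x y c).
- by move=> x y c; case: (fan_step_mul x y c).
- have bot t : exists p, fan_bot t = fan_gen_val p.
    by exists (inr (enc t)); rewrite /= encK.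
  move=> q [[c|u]|] //=; case: q => [[i q]|u] //=.
  case: (own_view i c) => [[b|]|] //.
  have [p ->] := rest_gen q b.
  by exists (inl (existT _ i p)).
- move=> P Pgen PM; apply: fanP => [i s|t]; last first.
    by rewrite -[t]encK; apply: (Pgen (inr _)).
  elim/(@gen_ind _ (D i)): s => [q|s t Ps Pt].
    exact: (Pgen (inl (existT _ i q))).
  by rewrite -fan_in_mul; apply: PM.
- exact: fan_act_inj.
Qed.

End Fan.

Theorem proposition8 (k : nat) (S : 'I_k -> semigroupType) (T : semigroupType)
    (phi : forall i : 'I_k, {multiplicative S i -> T})
    (S_aut : forall i : 'I_k, automaton_semigroup (S i))
    (T_fin : finite_set [set: T]%classic)
    (T_rz : exists z : T, is_right_zero z) :
  automaton_semigroup (strong_semilattice (fan_system phi)).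
Proof.
have D i : self_similar (S i).
  exact: inhabited_witness (automaton_self_similar (S_aut i)).
have /finite_seqP[s Ts] := T_fin.
have sP t : t \in s.
  by have : [set: T]%classic t by []; rewrite Ts.
have [z zP] := T_rz.
apply: self_similar_automaton.
exact: (@fan_self_similar _ _ _ phi D (seq_sub s)
          (fun t => SeqSub (sP t)) val (fun=> erefl) z zP).
Qed.
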